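(* Let $u^\dagger\in\mathcal X$ and $\eta^\dagger\in\mathbb R^K$, and let $y^\dagger=Au^\dagger+\eta^\dagger$. Let an initial ensemble $u^{(j)}(0)\in\mathcal X$, $j=1,\dots,J$, be given, and let $u^{(j)}(t)$, $t\ge 0$, $j=1,\dots,J$, be the solution of $$\frac{\mathrm d u^{(j)}}{\mathrm d t}=\frac1J\sum_{k=1}^J\bigl\langle A(u^{(k)}-\overline u),\,y^\dagger-Au^{(j)}\bigr\rangle_\Gamma\,(u^{(k)}-\overline u),\qquad j=1,\dots,J,$$ where $\overline u=\frac1J\sum_{k=1}^J u^{(k)}$, with these initial values. Let $E(t)\in\mathbb R^{J\times J}$ be the matrix with entries $E_{lj}(t)=\langle Ae^{(l)}(t),Ae^{(j)}(t)\rangle_\Gamma$, where $e^{(j)}(t)=u^{(j)}(t)-\overline u(t)$. Then $E(t)$ converges to $0$ as $t\to\infty$ with an algebraic rate of convergence: $\|E(t)\|=\mathcal O(Jt^{-1})$.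
   Context: $\mathcal X$ is a separable Hilbert space, $K,J\in\mathbb N$ are fixed, $A\in\mathcal L(\mathcal X,\mathbb R^K)$ is a bounded linear operator, and $\Gamma\in\mathbb R^{K\times K}$ is symmetric positive definite. For $a,b\in\mathbb R^K$, $\langle a,b\rangle_\Gamma=\langle\Gamma^{-1/2}a,\Gamma^{-1/2}b\rangle$ with $\langle\cdot,\cdot\rangle$ the Euclidean inner product. $\|\cdot\|$ denotes a matrix norm on $\mathbb R^{J\times J}$ (all such norms are equivalent for fixed $J$). The system of differential equations has a unique solution for all $t\ge0$, with values in the linear span of the initial ensemble. *)

(* Defs.v *)
From HB Require Import structures.
From mathcomp Require Import all_boot all_order all_algebra.
From mathcomp Require Import all_classical all_reals all_analysis.
From mathcomp Require Import complex.

Set Implicit Arguments.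
Unset Strict Implicit.
Unset Printing Implicit Defensive.

Import Order.TTheory GRing.Theory Num.Theory.
Import numFieldNormedType.Exports.
Local Open Scope classical_set_scope.
Local Open Scope ring_scope.

Definition separable (T : topologicalType) : Prop :=
  exists2 D : set T, countable D & dense D.

(* With the completeness of [X], this makes [X] a real Hilbert space. *)
Definition induces_norm (R : realType) (X : normedModType R)
    (ip : {dot X for idfun}) : Prop :=
  forall x : X, `|x| ^+ 2 = ip x x.

(* Nonnegativity is a consequence of these axioms. *)
Definition is_norm (R : realType) (V : lmodType R) (N : V -> R) : Prop :=
  [/\ forall x y, N (x + y) <= N x + N y,
      forall (a : R) x, N (a *: x) = `|a| * N x
    & forall x, N x = 0 -> x = 0].

Definition sympd (R : realType) (n : nat) (M : 'M[R]_n) : Prop :=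
  M^T = M /\ forall v : 'cV[R]_n, v != 0 -> 0 < (v^T *m M *m v) 0 0.

(* The symmetric positive definite square root; [sqrtmxP] and
   [sqrtmx_uniq] below show that it exists and is unique when [M] is itself
   symmetric positive definite, so that the default value 0 is irrelevant. *)
Definition sqrtmx (R : realType) (n : nat) (M : 'M[R]_n) : 'M[R]_n :=
  xget 0 [set S : 'M[R]_n | sympd S /\ S *m S = M].

Lemma interpolation (R : realType) (f : R -> R) (s : seq R) :
  exists q : {poly R}, {in s, forall x, q.[x] = f x}.
Proof.
elim: s => [|x s [q qE]]; first by exists 0.
have [xs|xs] := boolP (x \in s).
  by exists q => z; rewrite inE => /orP[/eqP->|]; exact: qE.
pose p := \prod_(z <- s) ('X - z%:P).
have px : p.[x] != 0 by rewrite -[_ == 0]/(root p x) root_prod_XsubC.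
exists (q + ((f x - q.[x]) / p.[x]) *: p) => z; rewrite inE !hornerE.
case/orP => [/eqP->|zs]; first by rewrite divfK// addrC subrK.
have /eqP -> : root p z by rewrite root_prod_XsubC.
by rewrite mulr0 addr0 qE.
Qed.

Lemma sympd_eigenvalue_gt0 (R : realType) n (M : 'M[R]_n) (a : R) :
  sympd M -> eigenvalue M a -> 0 < a.
Proof.
move=> [_ Mpos] /eigenvalueP[v vM v0].
have vT0 : v^T != 0 by rewrite -(inj_eq trmx_inj) trmxK trmx0.
have := Mpos _ vT0; rewrite trmxK vM -scalemxAl mxE pmulr_lgt0//.
rewrite lt_neqAle eq_sym mxE; apply/andP; split; last first.
  by apply: sumr_ge0 => i _; rewrite mxE -expr2 sqr_ge0.
apply: contraNneq v0 => /eqP; rewrite psumr_eq0; last first.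
  by move=> i _; rewrite mxE -expr2 sqr_ge0.
move=> /allP v0; apply/eqP/rowP => i; rewrite [RHS]mxE.
have := v0 i (mem_index_enum _); rewrite mxE -expr2 sqrf_eq0.
by move/eqP.
Qed.

Lemma sympd_spectrum (R : realType) n (M : 'M[R]_n.+1) : sympd M ->
  exists2 s : seq R, {in s, forall a, 0 < a} &
    forall p : {poly R}, {in s, forall a, root p a} -> horner_mx M p = 0.
Proof.
move=> Mspd; set toC := real_complex R.
have Msym := Mspd.1.
set Mc := map_mx toC M.
have Mreal : Mc \is a realmx.
  by apply/mxOverP => i j; rewrite mxE; apply/complex_realP; eexists.
have Mherm : Mc \is hermsymmx.
  apply: realsym_hermsym => //; apply/is_hermitianmxP.
  by rewrite expr0 scale1r map_mx_id // /Mc map_trmx Msym.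
have /orthomx_spectralP := hermitian_normalmx Mherm.
have /mxOverP dreal := hermitian_spectral_diag_real Mherm.
set P := spectralmx Mc in dreal *; set d := spectral_diag Mc in dreal * => McE.
have Pu : P \in unitmx by exact: spectral_unit.
pose e i := complex.Re (d 0 i).
have dE i : d 0 i = toC (e i) by rewrite [RHS]RRe_real.
exists [seq e i | i <- enum 'I_n.+1] => [a /mapP[i _ ->{a}]|p pM].
  apply: (sympd_eigenvalue_gt0 Mspd).
  suff: eigenvalue Mc (d 0 i).
    by rewrite dE !eigenvalue_root_char -map_char_poly fmorph_root.
  apply/eigenvalueP; exists (row i P).
    rewrite -row_mul {1}McE !mulmxA mulmxV// mul1mx.
    apply/rowP => k; rewrite !mxE (bigD1 i)//= !mxE eqxx mulr1n big1 ?addr0//.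
    by move=> j ji; rewrite !mxE eq_sym (negbTE ji) mulr0n mul0r.
  apply: contraTneq Pu => Pi0.
  rewrite -row_free_unit; apply/negP => /row_freeP[Q PQ].
  have : row i (P *m Q) 0 i = 0 by rewrite row_mul Pi0 mul0mx mxE.
  by rewrite PQ !mxE eqxx => /eqP; rewrite oner_eq0.
apply: (map_mx_inj (f := toC)).
rewrite map_horner_mx -/Mc map_mx0 McE horner_mx_uconjC// horner_mx_diag.
suff -> : map_mx (horner (map_poly toC p)) d = 0.
  by rewrite linear0 mulmx0 mul0mx.
apply/rowP => i; rewrite !mxE; apply/eqP.
by rewrite dE -[_ == 0]/(root _ _) fmorph_root pM// map_f// mem_enum.
Qed.

Lemma sympd_unit (R : realType) n (M : 'M[R]_n) : sympd M -> M \in unitmx.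
Proof.
move=> Mspd; rewrite -row_free_unit -kermx_eq0; apply/negP => /negP/rowV0Pn.
move=> [v /sub_kermxP vM v0].
suff : 0 < (0 : R) by rewrite ltxx.
by apply: (sympd_eigenvalue_gt0 Mspd); apply/eigenvalueP; exists v => //;
  rewrite vM scale0r.
Qed.

Lemma sympd_sqr (R : realType) n (T : 'M[R]_n) :
  T^T = T -> T \in unitmx -> sympd (T *m T).
Proof.
move=> Tsym Tu; split=> [|v v0]; first by rewrite trmx_mul Tsym.
rewrite mulmxA -mulmxA -{1}Tsym -trmx_mul mxE.
have Tv0 : T *m v != 0.
  by apply: contra_neq v0 => Tv0; rewrite -(mulKmx Tu v) Tv0 mulmx0.
rewrite lt_neqAle eq_sym; apply/andP; split; last first.
  by apply: sumr_ge0 => i _; rewrite mxE -expr2 sqr_ge0.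
apply: contraNneq Tv0 => /eqP; rewrite psumr_eq0; last first.
  by move=> i _; rewrite mxE -expr2 sqr_ge0.
move=> /allP h; apply/eqP/colP => i; rewrite [RHS]mxE.
by have := h i (mem_index_enum _); rewrite mxE -expr2 sqrf_eq0 => /eqP.
Qed.

Lemma sympdD (R : realType) n (S T : 'M[R]_n) :
  sympd S -> sympd T -> sympd (S + T).
Proof.
move=> [Ss Sp] [Ts Tp]; split=> [|v v0]; first by rewrite linearD /= Ss Ts.
by rewrite mulmxDr mulmxDl mxE addr_gt0 ?Sp ?Tp.
Qed.

Lemma horner_mx_sym (R : realType) n (M : 'M[R]_n.+1) (p : {poly R}) :
  M^T = M -> (horner_mx M p)^T = horner_mx M p.
Proof.
move=> Ms; elim/poly_ind: p => [|p c IH]; first by rewrite rmorph0 trmx0.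
rewrite rmorphD rmorphM /= horner_mx_X horner_mx_C linearD /= tr_scalar_mx.
by rewrite trmx_mul Ms IH -[in LHS]comm_horner_mx.
Qed.

Lemma horner_mxM (R : realType) n (M : 'M[R]_n.+1) (p q : {poly R}) :
  horner_mx M (p * q) = horner_mx M p *m horner_mx M q.
Proof. exact: rmorphM. Qed.

Lemma sympd_sqrt_poly (R : realType) n (M : 'M[R]_n.+1) : sympd M ->
  exists q : {poly R}, sympd (horner_mx M q) /\
    horner_mx M q *m horner_mx M q = M.
Proof.
move=> Mspd; have [s s_gt0 sM] := sympd_spectrum Mspd.
have [r rE] := interpolation (fun x => Num.sqrt (Num.sqrt x)) s.
have r4 : horner_mx M (r ^+ 2) *m horner_mx M (r ^+ 2) = M.
  rewrite -horner_mxM; apply/eqP; rewrite -subr_eq0.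
  have -> : horner_mx M (r ^+ 2 * r ^+ 2) - M
      = horner_mx M (r ^+ 2 * r ^+ 2 - 'X) by rewrite rmorphB /= horner_mx_X.
  apply/eqP/sM => a sa; apply/eqP.
  rewrite hornerD hornerN hornerX hornerM !horner_exp rE// sqr_sqrtr//.
  by rewrite -expr2 sqr_sqrtr ?subrr// ltW// s_gt0.
exists (r ^+ 2); split => //.
rewrite expr2 horner_mxM; apply: sympd_sqr; first exact/horner_mx_sym/Mspd.1.
have := sympd_unit Mspd; rewrite -{1}r4 expr2 horner_mxM.
by rewrite !unitmx_mul => /andP[/andP[]].
Qed.

Lemma sympd_sqrt_ex (R : realType) n (M : 'M[R]_n) : sympd M ->
  exists S, sympd S /\ S *m S = M.
Proof.
case: n M => [M Mspd|n M /sympd_sqrt_poly[q]]; last by exists (horner_mx M q).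
by exists M; split => //; rewrite [LHS]thinmx0 [RHS]thinmx0.
Qed.

Lemma sympd_sqrt_inj (R : realType) n (S T : 'M[R]_n) :
  sympd S -> sympd T -> S *m S = T *m T -> S = T.
Proof.
case: n S T => [S T _ _ _|n S T Sspd Tspd ST]; first by rewrite [S]thinmx0 [T]thinmx0.
have SSspd : sympd (S *m S) by apply: sympd_sqr Sspd.1 (sympd_unit Sspd).
have [q [Qspd QQ]] := sympd_sqrt_poly SSspd.
suff inj U : sympd U -> U *m U = S *m S -> U = horner_mx (S *m S) q.
  by rewrite (inj S)// (inj T).
move=> Uspd UU; set Q := horner_mx _ q in Qspd QQ *.
have UQ : Q *m U = U *m Q.
  by apply: comm_horner_mx; rewrite -UU /comm_mx mulmxA.
apply/eqP; rewrite -subr_eq0; apply/eqP.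
rewrite -[LHS](mulmxK (sympd_unit (sympdD Uspd Qspd))).
by rewrite mulmxDr !mulmxBl UU QQ UQ addrC subrKA subrr mul0mx.
Qed.

Lemma sqrtmxP (R : realType) n (M : 'M[R]_n) : sympd M ->
  sympd (sqrtmx M) /\ sqrtmx M *m sqrtmx M = M.
Proof.
move=> /sympd_sqrt_ex[S SP].
exact: (@xgetPex _ 0 [set S | sympd S /\ S *m S = M] (ex_intro _ S SP)).
Qed.

Lemma sqrtmx_uniq (R : realType) n (S : 'M[R]_n) :
  sympd S -> sqrtmx (S *m S) = S.
Proof.
move=> Sspd; have [] := @sqrtmxP _ _ (S *m S).
  exact: sympd_sqr Sspd.1 (sympd_unit Sspd).
by move=> Qspd /sympd_sqrt_inj; apply.
Qed.

Definition dotcv (R : realType) (n : nat) (a b : 'cV[R]_n) : R :=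
  \sum_(i < n) a i 0 * b i 0.

(* The inner product <Gamma^{-1/2} a, Gamma^{-1/2} b>, with Gamma = [G]. *)
Definition dotG (R : realType) (K : nat) (G : 'M[R]_K) (a b : 'cV[R]_K) : R :=
  dotcv (invmx (sqrtmx G) *m a) (invmx (sqrtmx G) *m b).

(* Difference quotients are restricted to [D], so that for [D] = [0, +oo[ this
   is the derivative at [t > 0] and the right derivative at [t = 0]. *)
Definition is_derive_within (R : realType) (X : normedModType R) (D : set R)
    (f : R -> X) (t : R) (df : X) : Prop :=
  (fun s => (s - t)^-1 *: (f s - f t)) @ within D t^' --> df.

Section Ensemble.
Context (R : realType) (X : normedModType R) (K J : nat).

Definition ens_mean (u : 'I_J -> X) : X := J%:R^-1 *: \sum_(k < J) u k.

Definition ens_dev (u : 'I_J -> X) (j : 'I_J) : X := u j - ens_mean u.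

Definition eki_field (A : X -> 'cV[R]_K) (G : 'M[R]_K) (y : 'cV[R]_K)
    (u : 'I_J -> X) (j : 'I_J) : X :=
  J%:R^-1 *: \sum_(k < J) dotG G (A (ens_dev u k)) (y - A (u j)) *: ens_dev u k.

Definition eki_solution (A : X -> 'cV[R]_K) (G : 'M[R]_K) (y : 'cV[R]_K)
    (u0 : 'I_J -> X) (u : R -> 'I_J -> X) : Prop :=
  u 0 = u0 /\
  forall t, 0 <= t -> forall j : 'I_J,
    is_derive_within [set s | 0 <= s] (fun s => u s j) t
      (eki_field A G y (u t) j).

Definition ens_gram (A : X -> 'cV[R]_K) (G : 'M[R]_K) (u : 'I_J -> X) :
    'M[R]_J :=
  \matrix_(l < J, j < J) dotG G (A (ens_dev u l)) (A (ens_dev u j)).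

End Ensemble.

(* Main.v *)
Require Import Defs.
From HB Require Import structures.
From mathcomp Require Import all_boot all_order all_algebra.
From mathcomp Require Import all_classical all_reals all_analysis.
From mathcomp Require Import ring lra.

Set Implicit Arguments.
Unset Strict Implicit.
Unset Printing Implicit Defensive.

Import Order.TTheory GRing.Theory Num.Theory.
Import numFieldNormedType.Exports.
Local Open Scope classical_set_scope.
Local Open Scope ring_scope.

(** In the deviations [e_j = u_j - mean] the data [y] cancels: averaging the
    field over [j] replaces [A u_j] by [A mean], so that
    [e_j' = - 1/J sum_k E_kj e_k] ([ens_dev_field]).  Applying [A] and pairing
    with [A e_l] gives the matrix Riccati equation [E' = - (2/J) E^2].

    Only its diagonal has to be integrated.  As [E] is symmetric,
    [E_jj' = - (2/J) sum_k E_jk^2 <= - (2/J) E_jj^2], and [E_jj >= 0] is a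
    squared length; comparison with the scalar Riccati equation
    ([riccati_decay]) yields [E_jj t <= J / (2 t)] whatever the initial
    ensemble.  The off-diagonal entries are inner products, hence bounded by
    [(E_ll + E_jj) / 2] ([dotG_le_mean]), so they satisfy the same bound.  A
    norm on matrices is controlled by the largest entry
    ([is_norm_entrywise]).  This gives the rate for the given norm, and, for the
    norm that defines the topology of matrices, the convergence to 0. *)

(** * Scalar Riccati inequality *)

(** Where [f] is positive, [(1/f)' = - f'/f^2 >= c], so [1/f] grows at least
    like [c t].  Since [f] decreases, it is positive on all of ]0, t] as soon
    as [f t > 0].  No initial value enters: the mean value theorem is applied on
    [[a, t]] with [a] tending to 0 and [1 / f a] is dropped. *)
Lemma riccati_decay (R : realType) (f df : R -> R) (c : R) : 0 < c ->
  (forall t, 0 < t -> 0 <= f t) ->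
  (forall t : R, 0 < t -> is_derive t 1 f (df t)) ->
  (forall t, 0 < t -> df t <= - (c * f t ^+ 2)) ->
  forall t, 0 < t -> f t <= (c * t)^-1.
Proof.
move=> c0 f0 fd dfle t t0.
have ct0 : 0 < c * t by rewrite mulr_gt0.
have [|ft0] := leP (f t) 0.
  by move=> /le_trans; apply; rewrite invr_ge0 ltW.
have fcont (s : R) : 0 < s -> {for s, continuous f}.
  by move=> /fd[fs _]; exact/differentiable_continuous/derivable1_diffP.
have decr a : 0 < a -> a <= t -> f t <= f a.
  move=> a0; rewrite le_eqVlt => /predU1P[->//|at_].
  have [||s] := @MVT R f df a t at_.
  - move=> s; rewrite in_itv /= => /andP[as_ _].
    by apply: fd; exact: lt_trans as_.
  - apply/continuous_in_subspaceT => s /[!inE] /=.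
    by rewrite in_itv /= => /andP[/(lt_le_trans a0) /fcont].
  - rewrite in_itv /= => /andP[as_ _] fE.
    rewrite -subr_le0 fE mulr_le0_ge0 ?subr_ge0 ?(ltW at_)//.
    have s0 := lt_trans a0 as_.
    apply: le_trans (dfle _ s0) _.
    by rewrite oppr_le0 mulr_ge0 ?sqr_ge0// ltW.
have fpos a : 0 < a -> a <= t -> 0 < f a.
  by move=> a0 at_; exact: lt_le_trans ft0 (decr _ a0 at_).
rewrite -[f t]invrK lef_pV2 ?posrE ?invr_gt0//.
apply/ler_addgt0Pr => e e0.
have [cte|ect] := leP (c * t) e.
  by apply: le_trans cte _; rewrite lerDr invr_ge0 ltW.
(* The part of the interval before [a] contributes only [c * a = e]. *)
pose a := e / c.
have a0 : 0 < a by rewrite divr_gt0.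
have at_ : a < t by rewrite ltr_pdivrMr // mulrC.
have [||s] := @MVT R (fun s => (f s)^-1) (fun s => - (f s) ^- 2 *: df s) a t at_.
- move=> s; rewrite in_itv /= => /andP[as_ st].
  have s0 := lt_trans a0 as_.
  by apply: is_deriveV; [rewrite gt_eqF ?fpos ?ltW|exact: fd].
- apply/continuous_in_subspaceT => s /[!inE] /=.
  rewrite in_itv /= => /andP[as_ st].
  have s0 := lt_le_trans a0 as_.
  by apply: cvgV; [rewrite gt_eqF ?fpos|exact: fcont].
rewrite in_itv /= => /andP[as_ st] gE.
have s0 := lt_trans a0 as_.
have fs0 := fpos _ s0 (ltW st).
have ga0 : 0 < (f a)^-1 by rewrite invr_gt0 fpos// ltW.
have slope : c <= - (f s) ^- 2 *: df s.
  rewrite scaleNr -scalerN /GRing.scale /= mulrC ler_pdivlMr ?exprn_gt0//.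
  by rewrite lerNr dfle.
have := ler_wpM2r (ltW (etrans (subr_gt0 a t) at_)) slope.
rewrite -gE mulrBr [c * a]mulrC divfK ?gt_eqF// => h.
lra.
Qed.

(** * Derivatives *)

(** For [t > 0] the half-line is a neighbourhood of [t], so restricting the
    difference quotients to it does not change their limit. *)
Lemma is_derive_of_within (R : realType) (V : normedModType R) (f : R -> V)
    (t : R) (df : V) : 0 < t ->
  is_derive_within [set s | 0 <= s] f t df -> is_derive t 1 f df.
Proof.
move=> t0 fdf.
suff h : (fun h => h^-1 *: ((f \o shift t) (h *: 1) - f t)) @ 0^' --> df.
  by split; [apply/cvg_ex; exists df|exact: cvg_lim].
have -> : (fun h => h^-1 *: ((f \o shift t) (h *: 1) - f t)) =
   (fun s => (s - t)^-1 *: (f s - f t)) \o (fun h => h + t).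
  by apply/funext => h /=; rewrite addrK [h *: 1]mulr1.
apply: cvg_comp fdf => P /= /nbhs_ballP[e /= e0 Pe].
apply/nbhs_ballP; exists (Num.min e t) => /=; first by rewrite lt_min e0.
move=> h; rewrite /ball /= sub0r normrN lt_min => /andP[he ht] h0.
apply: Pe.
- by rewrite /ball /= opprD addrCA subrr addr0 normrN.
- by rewrite -subr_eq0 addrK.
- by move: ht; rewrite ltr_norml => /andP[]; lra.
Qed.

(** A continuous linear map commutes with the limit of difference quotients. *)
Lemma is_derive_linear (R : realType) (V W : normedModType R)
    (L : {linear V -> W}) (f : R -> V) (t : R) (df : V) :
  continuous L -> is_derive t 1 f df -> is_derive t 1 (L \o f) (L df).
Proof.
move=> Lc [fd <-].
suff h : (fun h => h^-1 *: (((L \o f) \o shift t) (h *: 1) - (L \o f) t)) @ 0^'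
   --> L ('D_1 f t).
  by split; [apply/cvg_ex; eexists; exact: h|exact: cvg_lim h].
have -> : (fun h => h^-1 *: (((L \o f) \o shift t) (h *: 1) - (L \o f) t)) =
   L \o (fun h => h^-1 *: ((f \o shift t) (h *: 1) - f t)).
  by apply/funext => h /=; rewrite linearZ -linearB.
exact: (cvg_comp _ _ fd (Lc _)).
Qed.

(** * Norms on matrices *)

Section mxnorm.
Context (R : realType) (m n : nat) (N : 'M[R]_(m, n) -> R) (NP : is_norm N).

Lemma is_norm_ge0 M : 0 <= N M.
Proof.
have [ND NZ _] := NP.
have := ND M (- M); rewrite subrr -scaleN1r NZ normrN1 mul1r.
by rewrite -(scale0r (0 : 'M[R]_(m, n))) NZ normr0 mul0r; lra.
Qed.

(** Half of the equivalence of norms in finite dimension: expand [M] in the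
    canonical basis of matrix units and use the triangle inequality. *)
Lemma is_norm_entrywise (M : 'M[R]_(m, n)) (b : R) :
  (forall i j, `|M i j| <= b) ->
  N M <= (\sum_i \sum_j N (delta_mx i j)) * b.
Proof.
move=> Mb; have [ND NZ _] := NP.
have N0 : N 0 = 0 by rewrite -(scale0r (0 : 'M[R]_(m, n))) NZ normr0 mul0r.
have Nsum (I : finType) (F : I -> 'M[R]_(m, n)) (B : I -> R) :
    (forall i, N (F i) <= B i) -> N (\sum_i F i) <= \sum_i B i.
  move=> FB; apply: (big_rec2 (fun x y => N x <= y)); first by rewrite N0.
  by move=> i x y _ xy; apply: le_trans (ND _ _) _; exact: lerD.
rewrite [M in N M]matrix_sum_delta mulr_suml; apply: (Nsum _) => i.
rewrite mulr_suml; apply: (Nsum _) => j.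
by rewrite NZ mulrC ler_wpM2l ?is_norm_ge0.
Qed.

End mxnorm.

(** * The weighted inner product *)

Section dotG.
Context (R : realType) (K : nat) (G : 'M[R]_K).

Definition whiten (a : 'cV[R]_K) (i : 'I_K) : R := (invmx (sqrtmx G) *m a) i 0.

Lemma dotGE a b : dotG G a b = \sum_(i < K) whiten a i * whiten b i.
Proof. by []. Qed.

Lemma dotGC a b : dotG G a b = dotG G b a.
Proof. by apply: eq_bigr => i _; rewrite mulrC. Qed.

Lemma dotGDr a b c : dotG G a (b + c) = dotG G a b + dotG G a c.
Proof.
rewrite /dotG mulmxDr /dotcv -big_split; apply: eq_bigr => i _.
by rewrite !mxE mulrDr.
Qed.

Lemma dotGZr x a b : dotG G a (x *: b) = x * dotG G a b.
Proof.
rewrite /dotG -scalemxAr /dotcv mulr_sumr; apply: eq_bigr => i _.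
by rewrite !mxE mulrCA.
Qed.

Lemma dotGNr a b : dotG G a (- b) = - dotG G a b.
Proof. by rewrite -scaleN1r dotGZr mulN1r. Qed.

Lemma dotG_sumr (I : finType) a (F : I -> 'cV[R]_K) :
  dotG G a (\sum_i F i) = \sum_i dotG G a (F i).
Proof.
elim/big_rec2 : _ => [|i x y _ <-]; last by rewrite dotGDr.
by rewrite -(scale0r (0 : 'cV[R]_K)) dotGZr mul0r.
Qed.

Lemma dotG_ge0 a : 0 <= dotG G a a.
Proof. by apply: sumr_ge0 => i _; rewrite -expr2 sqr_ge0. Qed.

(** Coordinatewise [2 |x y| <= x^2 + y^2]; this arithmetic form of the
    Cauchy-Schwarz inequality suffices since both diagonal entries obey the same
    bound. *)
Lemma dotG_le_mean a b : `|dotG G a b| <= (dotG G a a + dotG G b b) / 2.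
Proof.
rewrite !dotGE -big_split mulr_suml; apply: (le_trans (ler_norm_sum _ _ _)).
apply: ler_sum => i _; set x := whiten a i; set y := whiten b i.
have := sqr_ge0 (x + y); have := sqr_ge0 (x - y).
by rewrite !sqrrD ler_norml sqrrN mulrN !expr2 /=; lra.
Qed.

Lemma is_derive_dotG (f g : R -> 'cV[R]_K) (t : R) (df dg : 'cV[R]_K) :
  is_derive t 1 f df -> is_derive t 1 g dg ->
  is_derive t 1 (fun s => dotG G (f s) (g s))
    (dotG G df (g t) + dotG G (f t) dg).
Proof.
have whitenD (h : R -> 'cV[R]_K) (dh : 'cV[R]_K) i : is_derive t 1 h dh ->
    is_derive t 1 (fun s => whiten (h s) i) (whiten dh i).
  move=> hd.
  have coordD k : is_derive t 1 (fun s => h s k 0) (dh k 0).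
    pose c (M : 'cV[R]_K) : R^o := M k 0.
    have clin : linear c by move=> a x y; rewrite /c !mxE.
    pose cl : {linear 'cV[R]_K -> R^o} :=
      HB.pack c (GRing.isLinear.Build _ _ _ _ c clin).
    apply: (@is_derive_linear _ _ _ cl) => //; exact: coord_continuous.
  have := @is_derive_sum _ _ R^o K
    (fun k => invmx (sqrtmx G) i k \*: (fun s => h s k 0)) t 1 _
    (fun k => @is_deriveZ _ _ R^o _ _ _ _ _ (coordD k)).
  rewrite /whiten !mxE fct_sumE => H.
  have -> : (fun s => (invmx (sqrtmx G) *m h s) i 0) =
      (fun s => \sum_(k < K) invmx (sqrtmx G) i k * h s k 0).
    by apply/funext => s; rewrite mxE.
  exact: H.
move=> fd gd.
have := @is_derive_sum _ _ R^o K
    (fun i => (fun s => whiten (f s) i) * (fun s => whiten (g s) i)) t 1 _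
    (fun i => is_deriveM (whitenD _ _ i fd) (whitenD _ _ i gd)).
rewrite fct_sumE => /is_derive_eq; apply.
rewrite big_split /= addrC; congr (_ + _).
by apply: eq_bigr => i _; rewrite mulrC.
Qed.

End dotG.

(** * Evolution of the Gram matrix *)

Section eki.
Context (R : realType) (X : normedModType R) (K J : nat).
Context (A : {linear X -> 'cV[R]_K}) (G : 'M[R]_K) (y : 'cV[R]_K).

Let E (v : 'I_J -> X) := ens_gram A G v.

Lemma ens_gramC v l j : E v l j = E v j l.
Proof. by rewrite !mxE dotGC. Qed.

(** Both the velocity of member [j] and the mean velocity are combinations of
    the same deviations [e_k]; their coefficients differ by
    [<A e_k, (y - A u_j) - (y - A mean)> = - E_kj]. *)
Lemma ens_dev_field (v : 'I_J -> X) j :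
  ens_dev (eki_field A G y v) j =
    - (J%:R^-1 *: \sum_(k < J) E v k j *: ens_dev v k).
Proof.
have J0 : J%:R != 0 :> R.
  by rewrite pnatr_eq0 -lt0n; case: (J) j => [[]|].
have meanE : ens_mean (eki_field A G y v) = J%:R^-1 *:
    \sum_(k < J) dotG G (A (ens_dev v k)) (y - A (ens_mean v)) *: ens_dev v k.
  rewrite {1}/ens_mean -scaler_sumr; congr (_ *: _).
  rewrite exchange_big scaler_sumr /=; apply: eq_bigr => k _.
  rewrite -scaler_suml scalerA -dotG_sumr -dotGZr; congr (dotG G _ _ *: _).
  rewrite sumrB sumr_const card_ord scalerBr -(scaler_nat J y) scalerA mulVf//.
  by rewrite scale1r /ens_mean -linear_sum -linearZ.
rewrite {1}/ens_dev meanE /eki_field -scalerBr -scalerN -sumrB -sumrN.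
congr (_ *: _); apply: eq_bigr => k _; rewrite -scalerBl -scaleNr.
congr (_ *: _); rewrite mxE -!dotGNr -dotGDr; congr dotG.
by rewrite [in RHS]linearB /= !opprB addrC addrA subrK.
Qed.

Lemma is_derive_ens_dev (u : R -> 'I_J -> X) (du : 'I_J -> X) (t : R) j :
  (forall j, is_derive t 1 (fun s => u s j) (du j)) ->
  is_derive t 1 (fun s => ens_dev (u s) j) (ens_dev du j).
Proof.
move=> ud.
have := is_deriveB (ud j)
  (@is_deriveZ _ _ _ _ J%:R^-1 _ _ _ (is_derive_sum ud)).
by rewrite fct_sumE.
Qed.

(** The diagonal of [E' = - (2/J) E^2], where symmetry of [E] turns
    [(E^2)_jj] into a sum of squares. *)
Lemma ens_gram_diag_ode (u : R -> 'I_J -> X) (t : R) j : continuous A ->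
  (forall j, is_derive t 1 (fun s => u s j) (eki_field A G y (u t) j)) ->
  is_derive t 1 (fun s => E (u s) j j)
    (- (2 / J%:R * \sum_(k < J) E (u t) j k ^+ 2)).
Proof.
move=> Ac /is_derive_ens_dev ud.
have Aed := is_derive_linear Ac (ud j).
have := is_derive_dotG G Aed Aed.
have -> : (fun s => E (u s) j j) =
    (fun s => dotG G (A (ens_dev (u s) j)) (A (ens_dev (u s) j))).
  by apply/funext => s; rewrite mxE.
move=> /is_derive_eq; apply.
rewrite dotGC /= ens_dev_field.
have -> : A (- (J%:R^-1 *: \sum_(k < J) E (u t) k j *: ens_dev (u t) k)) =
    - J%:R^-1 *: \sum_(k < J) E (u t) j k *: A (ens_dev (u t) k).
  rewrite -scaleNr linearZ linear_sum; congr (_ *: _).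
  by apply: eq_bigr => k _; rewrite linearZ ens_gramC.
rewrite dotGZr dotG_sumr.
have -> : \sum_(k < J) dotG G (A (ens_dev (u t) j))
      (E (u t) j k *: A (ens_dev (u t) k)) = \sum_(k < J) E (u t) j k ^+ 2.
  by apply: eq_bigr => k _; rewrite dotGZr mxE expr2.
lra.
Qed.

(** Keeping only the square [E_jj^2] of the sum gives the scalar Riccati
    inequality with constant [2/J]. *)
Lemma ens_gram_diag_decay (u0 : 'I_J -> X) (u : R -> 'I_J -> X) j :
  continuous A -> eki_solution A G y u0 u ->
  forall t, 0 < t -> E (u t) j j <= J%:R / (2 * t).
Proof.
move=> Ac [_ usol] t t0.
have J0 : 0 < J%:R :> R by rewrite ltr0n; case: (J) j => [[]|].
have c0 : 0 < 2 / J%:R :> R by rewrite divr_gt0.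
have -> : J%:R / (2 * t) = (2 / J%:R * t)^-1.
  by rewrite !invfM invrK; ring.
apply: (@riccati_decay _ (fun s => E (u s) j j) (fun s =>
  - (2 / J%:R * \sum_(k < J) E (u s) j k ^+ 2)) _ c0) t0.
- by move=> s _ /=; rewrite mxE dotG_ge0.
- move=> s s0; apply: ens_gram_diag_ode => // k.
  by apply: is_derive_of_within => //; apply: usol; exact: ltW.
- move=> s _ /=; rewrite lerN2 ler_wpM2l ?(ltW c0)//.
  by rewrite (bigD1 j)//= lerDl sumr_ge0 // => k _; rewrite sqr_ge0.
Qed.

Lemma ens_gram_decay (u0 : 'I_J -> X) (u : R -> 'I_J -> X) :
  continuous A -> eki_solution A G y u0 u ->
  forall t, 0 < t -> forall l j, `|E (u t) l j| <= 2^-1 * (J%:R * t^-1).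
Proof.
move=> Ac usol t t0 l j.
rewrite [in leLHS]mxE; apply: le_trans (dotG_le_mean _ _ _) _.
have := ens_gram_diag_decay l Ac usol t0; have := ens_gram_diag_decay j Ac usol t0.
rewrite !mxE invfM; lra.
Qed.

End eki.

(** * Convergence *)

Theorem corollary3p2 (R : realType)
    (X : completeNormedModType R) (ip : {dot X for idfun})
    (Xhilbert : induces_norm ip) (Xsep : separable X)
    (K J : nat)
    (A : {linear X -> 'cV[R]_K}) (Abounded : bounded_near A (nbhs (0 : X)))
    (G : 'M[R]_K) (Gspd : sympd G)
    (mxnorm : 'M[R]_J -> R) (mxnormP : is_norm mxnorm)
    (udag : X) (etadag ydag : 'cV[R]_K) (ydagE : ydag = A udag + etadag)
    (u0 : 'I_J -> X) (u : R -> 'I_J -> X)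
    (usol : eki_solution A G ydag u0 u)
    (E : R -> 'M[R]_J) (EE : forall t, 0 <= t -> E t = ens_gram A G (u t)) :
  E t @[t --> +oo] --> (0 : 'M[R]_J) /\
  exists C : R, \forall t \near +oo, mxnorm (E t) <= C * (J%:R * t^-1).
Proof.
have Ac : continuous A by exact: bounded_linear_continuous.
(* Stated for every norm, because it is used both for [mxnorm] and for the norm
   that defines the topology. *)
have decay N : is_norm N ->
    exists C, forall t, 0 < t -> N (E t) <= C * (J%:R * t^-1).
  move=> NP; exists ((\sum_i \sum_j N (delta_mx i j)) * 2^-1) => t t0.
  rewrite EE ?(ltW t0)// -mulrA; apply: (is_norm_entrywise NP) => l j.
  exact: (ens_gram_decay Ac usol t0).
split; last first.
  have [C CE] := decay _ mxnormP; exists C.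
  by near=> t; apply: CE; near: t; exact: nbhs_pinfty_gt.
have [|C CE] := decay (fun M => `|M|).
  by split; [exact: ler_normD|exact: normrZ|move=> x /normr0_eq0].
apply/norm_cvg0P.
apply: (@squeeze_cvgr _ _ _ _ (cst 0) (fun t => C * J%:R * t^-1)).
- near=> t; have t0 : 0 < t by near: t; exact: nbhs_pinfty_gt.
  by rewrite normr_ge0 /= -mulrA CE.
- exact: cvg_cst.
- rewrite -[X in _ --> X](mulr0 (C * J%:R)); apply: cvgMr.
  apply/gtr0_cvgV0; last exact: cvg_id.
  exact: nbhs_pinfty_gt.
Unshelve. all: by end_near.
Qed.
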